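(* Let $P_F\subset[0,1]$ be the fractal prime set (defined in the context). Then the box-counting dimension of $P_F$ exists and $$\dim_H P_F=\dim_B P_F=\frac14 .$$
   Context: Let $p_n$ denote the $n$-th prime ($p_1=2,\ p_2=3,\ p_3=5,\dots$). For each $n\ge 1$ put $a_n = p_n \bmod 16\in\{0,\dots,15\}$ and $b_n=(a_n+8)\bmod 16\in\{0,\dots,15\}$. Define compact sets $F_n\subset[0,1]$ recursively. $F_0=[0,1]$. Given $F_{n-1}$ as a union of $2^{n-1}$ disjoint closed intervals $I_{n-1,k}=[x_k,\,x_k+16^{-(n-1)}]$ ($k=1,\dots,2^{n-1}$), divide each into 16 closed subintervals $I_{n-1,k}^{(j)}=[x_k+j\cdot16^{-n},\;x_k+(j+1)\cdot16^{-n}]$, $j=0,\dots,15$, and keep exactly those with indices $a_n$ and $b_n$: $F_n=\bigcup_{k=1}^{2^{n-1}}\bigl(I_{n-1,k}^{(a_n)}\cup I_{n-1,k}^{(b_n)}\bigr)$. The fractal prime set is $P_F=\bigcap_{n=0}^\infty F_n$. $\dim_H$ is the Hausdorff dimension: $\dim_H F$ is the infimum of those $s\ge0$ for which the $s$-dimensional Hausdorff measure of $F$ is zero. For a bounded non-empty $F\subset\mathbb{R}$, $N_\varepsilon(F)$ is the minimal number of closed intervals of length $\varepsilon$ needed to cover $F$; the lower and upper box-counting dimensions are $\liminf_{\varepsilon\to0}\frac{\log N_\varepsilon(F)}{-\log\varepsilon}$ and $\limsup_{\varepsilon\to0}\frac{\log N_\varepsilon(F)}{-\log\varepsilon}$,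 and if they coincide their common value is the box-counting dimension $\dim_B F$. *)

(* Defs.v *)
From HB Require Import structures.
From mathcomp Require Import all_boot all_order all_algebra.
From mathcomp Require Import all_classical all_reals all_analysis.

Set Implicit Arguments.
Unset Strict Implicit.
Unset Printing Implicit Defensive.

Import Order.TTheory GRing.Theory Num.Theory.
Import numFieldNormedType.Exports.

Local Open Scope classical_set_scope.
Local Open Scope ring_scope.

Section PrimeDigits.
Local Open Scope nat_scope.

Lemma exists_next_prime (m : nat) : exists p, (m < p) && prime p.
Proof. by have [p mp pp] := prime_above m; exists p; rewrite mp pp. Qed.

Definition next_prime (m : nat) : nat := ex_minn (exists_next_prime m).

(* 1-based: nth_prime 1 = 2, nth_prime 2 = 3, ...; nth_prime 0 = 0 is only
   the seed of the iteration and is not a prime. *)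
Definition nth_prime (n : nat) : nat := iter n next_prime 0.

Definition prime_digit (n : nat) : nat := nth_prime n %% 16.

Definition prime_codigit (n : nat) : nat := (prime_digit n + 8) %% 16.

End PrimeDigits.

Section FractalPrimeSet.
Variable R : realType.

(* The left endpoints x_k of the 2 ^ n closed intervals of length 16 ^- n
   that make up the n-th stage. *)
Fixpoint stage_ends (n : nat) : seq R :=
  if n is m.+1 then
    flatten [seq [:: x + (prime_digit m.+1)%:R * 16%:R ^- m.+1;
                     x + (prime_codigit m.+1)%:R * 16%:R ^- m.+1]
            | x <- stage_ends m]
  else [:: 0].

Definition stage (n : nat) : set R :=
  \bigcup_(x in [set` stage_ends n]) `[x, x + 16%:R ^- n]%classic.

Definition fractal_prime_set : set R := \bigcap_n stage n.

End FractalPrimeSet.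

Arguments stage R n : clear implicits.
Arguments fractal_prime_set R : clear implicits.

Section Dimensions.
Variable R : realType.
Implicit Types (F U : set R).
Local Open Scope ereal_scope.

(* The diameter of set0 is -oo here. *)
Definition diam U : \bar R :=
  ereal_sup [set `|x - y|%:E | x in U & y in U].

Definition delta_cover (delta : R) F (U : nat -> set R) : Prop :=
  F `<=` \bigcup_i U i /\ forall i, diam (U i) <= delta%:E.

(* Empty members of a cover contribute 0, also when s = 0; a nonempty set of
   diameter 0 contributes 0 if s > 0 and 1 if s = 0, so that the
   0-dimensional measure counts points. *)
Definition hausdorff_content (s delta : R) F : \bar R :=
  ereal_inf [set \sum_(0 <= i <oo | U i != set0) diam (U i) `^ s
            | U in delta_cover delta F].

(* hausdorff_content s delta F increases as delta decreases to 0, so its limit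
   is a supremum. *)
Definition hausdorff_measure (s : R) F : \bar R :=
  ereal_sup [set hausdorff_content s delta F
            | delta in [set delta : R | (0 < delta)%R]].

Definition hausdorff_dim F : \bar R :=
  ereal_inf [set s%:E
            | s in [set s : R | (0 <= s)%R /\ hausdorff_measure s F = 0]].

(* The infimum is a minimum when F is bounded and eps > 0; it is +oo when no
   finite cover exists. *)
Definition covering_number (eps : R) F : \bar R :=
  ereal_inf [set (size s)%:R%:E
            | s in [set s : seq R |
                     F `<=` \bigcup_(x in [set` s]) `[x, (x + eps)%R]%classic]].

Definition log_covering_ratio F (eps : R) : \bar R :=
  lne (covering_number eps F) * ((- ln eps)^-1)%:E.

Definition lower_box_dim F : \bar R :=
  limf_einf (log_covering_ratio F) (0%R : R)^'+.

Definition upper_box_dim F : \bar R :=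
  limf_esup (log_covering_ratio F) (0%R : R)^'+.

Definition box_dim_exists F : Prop := lower_box_dim F = upper_box_dim F.

(* Meaningful only under box_dim_exists F. *)
Definition box_dim F : \bar R := upper_box_dim F.

End Dimensions.

(* Main.v *)
Require Import Defs.
From mathcomp Require Import all_boot all_order all_algebra.
From mathcomp Require Import all_classical all_reals all_analysis.
From mathcomp Require Import ring lra zify.

(** The digits [a_k] and [b_k] kept at the [k]-th step are [c_k] and [c_k + 8],
    in some order, with [c_k = p_k mod 8].  Hence the set is
      [{ \sum_k (c_k + 8 * e_k) * 16 ^- k | e_k = 0, 1 }],
    a translate of one self-similar set with two pieces of ratio [1/16], and
    its dimension is [ln 2 / ln 16 = 1/4].  The primes enter only through the
    translation.

    Every dimension of [F] equals [a] as soon as, for constants [c, C > 0],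
    - [F] is covered by at most [C * e ^ (- a)] intervals of length [e], for
      every [e] in [(0, 1)];
    - every countable cover [U] of [F] has [c <= \sum_i diam (U i) ^ a].
    The first condition bounds the Hausdorff measures of exponent [s > a]
    by [C * e ^ (s - a)], which tends to [0]; the second keeps those of
    exponent [s < a] positive.  Applied to a cover by intervals of equal
    length, the second also gives [c * e ^ (- a) <= N_e], so the logarithmic
    ratio of the box-counting dimension is within [O(1 / - ln e)] of [a]
    ([hausdorff_dim_box_dim]).

    Here the first condition is read off the stages: the [n]-th one consists
    of [2 ^ n] intervals of length [16 ^- n]
    ([fractal_prime_set_few_intervals]).  For the second, let [p] send
    [y] in [[0, 1[] to the point of the set whose choices [e_k] are the binary
    digits of [y].  The two subintervals kept inside one interval of stage [n]
    are more than [16 ^- n.+1] apart, so points [p y], [p y'] closer than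
    [16 ^- n] share their first [n] choices, whence [`|y - y'| <= 2 ^- n].
    Thus the inverse of [p] is Hoelder:
    [`|y - y'| <= 2 * `|p y - p y'| ^ (1/4)]
    ([exists_parametrization]).  Pulling a cover of the set back along [p]
    covers [[0, 1[] by sets lying in intervals of length
    [4 * diam (U i) ^ (1/4)], and countable subadditivity of Lebesgue measure
    yields the second condition ([cover_mass_of_holder]).  *)

Set Implicit Arguments.
Unset Strict Implicit.
Unset Printing Implicit Defensive.

Import Order.TTheory GRing.Theory Num.Theory.
Import numFieldNormedType.Exports.

Local Open Scope classical_set_scope.
Local Open Scope ring_scope.

(** * Limits superior and inferior along a filter *)

Section FilterLimits.
Variables (R : realType) (X : choiceType) (T : filteredType X).
Local Open Scope ereal_scope.

Lemma limf_esup_squeeze (f : T -> \bar R) (F : set_system T) (a : R) :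
  ProperFilter F ->
  (forall e : R, (0 < e)%R -> F [set x | (a - e)%:E <= f x <= (a + e)%:E]) ->
  limf_esup f F = a%:E.
Proof.
move=> FF near_a; apply/eqP; rewrite limf_esupE eq_le; apply/andP; split.
  apply/lee_addgt0Pr => e e0; rewrite -EFinD; apply: ge_ereal_inf.
  eexists.
    by exists [set x | (a - e)%:E <= f x <= (a + e)%:E]; [exact: near_a|].
  by apply: ge_ereal_sup => _ [x /= /andP[_ ?] <-].
apply: le_ereal_inf_tmp => _ [W FW <-]; apply/lee_subgt0Pr => e e0.
have [x [Wx /andP[fx _]]] := filter_ex (filterI FW (near_a e e0)).
by apply: le_ereal_sup_tmp; exists (f x) => //; exists x.
Qed.

Lemma limf_einf_squeeze (f : T -> \bar R) (F : set_system T) (a : R) :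
  ProperFilter F ->
  (forall e : R, (0 < e)%R -> F [set x | (a - e)%:E <= f x <= (a + e)%:E]) ->
  limf_einf f F = a%:E.
Proof.
move=> FF near_a; rewrite /limf_einf (@limf_esup_squeeze _ _ (- a)%R).
  by rewrite EFinN oppeK.
move=> e /near_a; apply: filterS => x /=.
by rewrite leeNl leeNr -!EFinN => /andP[? ?]; apply/andP; split;
  [rewrite opprD opprK opprK|rewrite opprD opprK].
Qed.

End FilterLimits.

(** * Covers and diameters *)

Section Covers.
Variable R : realType.
Implicit Types (F U : set R) (a s e d : R) (t : seq R).
Local Open Scope ereal_scope.

Lemma diam_le U d : (forall x y, U x -> U y -> (`|x - y| <= d)%R) ->
  diam U <= d%:E.
Proof.
by move=> Ud; apply: ge_ereal_sup => _ [x Ux [y Uy <-]]; rewrite lee_fin Ud.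
Qed.

Lemma dist_le_diam U x y : U x -> U y -> `|x - y|%:E <= diam U.
Proof. by move=> Ux Uy; apply: ereal_sup_ubound; exists x => //; exists y. Qed.

Lemma diam_ge0 U : U != set0 -> 0 <= diam U.
Proof.
by move=> /set0P[x Ux]; apply: le_trans (dist_le_diam Ux Ux); rewrite lee_fin.
Qed.

(** A finite family of intervals padded with empty sets: Hausdorff covers are
    sequences, and an empty member contributes nothing to their sums. *)
Definition itv_cover t e (i : nat) : set R :=
  if (i < size t)%N then `[nth 0%R t i, (nth 0%R t i + e)%R]%classic else set0.

Lemma bigcup_itv_cover t e :
  \bigcup_i itv_cover t e i = \bigcup_(x in [set` t]) `[x, (x + e)%R]%classic.
Proof.
apply/seteqP; split=> [y [i _]|y [x /= xt xy]].
  rewrite /itv_cover; case: ifPn => // it xy.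
  by exists (nth 0%R t i) => //=; rewrite mem_nth.
by exists (index x t) => //; rewrite /itv_cover index_mem xt nth_index.
Qed.

Lemma diam_itv_cover t e i : (0 <= e)%R -> diam (itv_cover t e i) <= e%:E.
Proof.
move=> e0; apply: diam_le => x y; rewrite /itv_cover; case: ifPn => //= _.
rewrite !in_itv/= => /andP[? ?] /andP[? ?].
by rewrite ler_norml; apply/andP; lra.
Qed.

Lemma sum_diam_itv_cover t e a : (0 <= e)%R -> (0 <= a)%R ->
  \sum_(0 <= i <oo | itv_cover t e i != set0) diam (itv_cover t e i) `^ a
    <= ((size t)%:R * e `^ a)%:E.
Proof.
move=> e0 a0; rewrite (nneseries_split_cond 0%N (size t)); last first.
  by move=> *; exact: poweR_ge0.
rewrite add0n [X in _ + X]eseries0 ?adde0; last first.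
  by move=> i; rewrite leqNgt /itv_cover => /negbTE ->; rewrite eqxx.
apply: (@le_trans _ _ (\sum_(0 <= i < size t) (e `^ a)%:E)).
  rewrite big_mkcond/=; apply: lee_sum => i _.
  case: ifPn => Ui; last by rewrite lee_fin powR_ge0.
  rewrite -poweR_EFin; apply: gt0_ler_poweR => //.
  - by rewrite in_itv/= leey diam_ge0.
  - by rewrite in_itv/= leey lee_fin e0.
  - exact: diam_itv_cover.
by rewrite sumEFin lee_fin sumr_const_nat subn0 mulr_natl.
Qed.

Lemma hausdorff_measure_ge0 s F : 0 <= hausdorff_measure s F.
Proof.
apply: le_ereal_sup_tmp; exists (hausdorff_content s 1%R F).
  by exists 1%R => /=.
apply: le_ereal_inf_tmp => _ [U _ <-].
by apply: nneseries_ge0 => i _ _; exact: poweR_ge0.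
Qed.

End Covers.

(** * A criterion for all the dimensions to coincide *)

Section DimensionCriterion.
Variables (R : realType) (F : set R) (a c C : R).
Hypotheses (a0 : 0 < a) (c0 : 0 < c) (C0 : 0 < C).
Hypothesis cover_mass : forall U : nat -> set R, F `<=` \bigcup_i U i ->
  (c%:E <= \sum_(0 <= i <oo | U i != set0) diam (U i) `^ a)%E.
Hypothesis few_intervals : forall e : R, 0 < e < 1 -> exists2 t : seq R,
  F `<=` \bigcup_(x in [set` t]) `[x, (x + e)%R]%classic &
  (size t)%:R <= C * e `^ (- a).

(** In a cover by sets of diameter at most [1], lowering the exponent from [a]
    to [s] only increases each term, so the content at scale [1] stays above
    [c]. *)
Lemma hausdorff_dim_ge : (a%:E <= hausdorff_dim F)%E.
Proof.
apply: le_ereal_inf_tmp => _ [s [s0 Fs0] <-]; rewrite lee_fin leNgt.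
apply/negP => sa; suff : (c%:E <= hausdorff_measure s F)%E.
  by rewrite Fs0 lee_fin leNgt c0.
apply: le_ereal_sup_tmp; exists (hausdorff_content s 1 F).
  by exists 1 => /=.
apply: le_ereal_inf_tmp => _ [U [FU U1] <-].
apply: le_trans (cover_mass FU) _; apply: lee_nneseries => [i _ _|i Ui].
  exact: poweR_ge0.
have := diam_ge0 Ui; have := U1 i; case: (diam (U i)) => [d| |]//.
rewrite !poweR_EFin !lee_fin => d1; rewrite le_eqVlt => /orP[/eqP <-|d0].
  by rewrite powR0 ?gt_eqF// powR_ge0.
by apply: ger_powR; rewrite ?d0 ?d1 // ltW.
Qed.

(** At the exponent [a + h] a cover by intervals of length [e] costs at most
    [C * e `^ (- a) * e `^ (a + h) = C * e `^ h], which is arbitrarily small. *)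
Lemma hausdorff_dim_le : (hausdorff_dim F <= a%:E)%E.
Proof.
apply/lee_addgt0Pr => h h0; rewrite -EFinD; apply: ereal_inf_lbound.
exists (a + h) => //; split; first by rewrite addr_ge0 ?ltW.
apply/eqP; rewrite eq_le hausdorff_measure_ge0 andbT.
apply: ge_ereal_sup => _ [d /= d0 <-].
apply/lee_addgt0Pr => k k0; rewrite add0e.
(* [(k / C) `^ h^-1] is the [e] at which the cost [C * e `^ h] equals [k]. *)
pose e := Num.min (Num.min d 2^-1) ((k / C) `^ h^-1).
have kC0 : 0 < k / C by rewrite divr_gt0.
have e0 : 0 < e by rewrite !lt_min d0 invr_gt0 ltr0n powR_gt0.
have ed : e <= d by rewrite /e !ge_min lexx.
have e1 : e < 1.
  by apply: (@le_lt_trans _ _ 2^-1); rewrite /e ?ge_min ?lexx ?orbT//; lra.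
have ek : e `^ h <= k / C.
  have -> : k / C = ((k / C) `^ h^-1) `^ h.
    by rewrite -powRrM mulVf ?gt_eqF// powRr1 ?ltW.
  apply: ge0_ler_powR; rewrite ?nnegrE ?powR_ge0 ?(ltW h0) ?(ltW e0)//.
  by rewrite /e !ge_min lexx orbT.
have [t Ft tC] := few_intervals (introT andP (conj e0 e1)).
apply: ge_ereal_inf; eexists.
  exists (itv_cover t e); last by [].
  split=> [|i]; first by rewrite bigcup_itv_cover.
  by apply: le_trans (diam_itv_cover _ _ (ltW e0)) _; rewrite lee_fin.
apply: le_trans (sum_diam_itv_cover _ (ltW e0) _) _.
  by rewrite addr_ge0 ?ltW.
rewrite lee_fin; apply: (@le_trans _ _ (C * e `^ (- a) * e `^ (a + h))).
  by rewrite ler_wpM2r ?powR_ge0.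
rewrite -mulrA -powRD ?(gt_eqF e0) ?implybT// addKr.
by rewrite mulrC -ler_pdivlMr.
Qed.

(** The lower bound is the mass condition for a cover by intervals of equal
    length: [N] of them have total mass [N * e `^ a]. *)
Lemma covering_number_bounds (e : R) : 0 < e < 1 ->
  ((c * e `^ (- a))%:E <= covering_number e F <= (C * e `^ (- a))%:E)%E.
Proof.
move=> e01; have /andP[e0 e1] := e01; apply/andP; split.
  apply: le_ereal_inf_tmp => _ [t /= Ft <-]; rewrite lee_fin powRN.
  rewrite ler_pdivrMr ?powR_gt0// -lee_fin.
  have := sum_diam_itv_cover t (ltW e0) (ltW a0).
  by apply: le_trans; apply: cover_mass; rewrite bigcup_itv_cover.
have [t Ft tC] := few_intervals e01.
by apply: ge_ereal_inf; exists (size t)%:R%:E; [exists t|rewrite lee_fin].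
Qed.

Lemma log_covering_ratio_bounds (e : R) : 0 < e < 1 ->
  ((a + ln c / - ln e)%:E <= log_covering_ratio F e
     <= (a + ln C / - ln e)%:E)%E.
Proof.
move=> e01; have /andP[e0 e1] := e01.
have L0 : 0 < - ln e by rewrite oppr_gt0 ln_lt0.
have ea0 : 0 < e `^ (- a) by rewrite powR_gt0.
have := covering_number_bounds e01; rewrite /log_covering_ratio.
case: (covering_number e F) => [N| |]//; last by rewrite andbC.
rewrite !lee_fin => /andP[cN NC].
have N0 : 0 < N by apply: lt_le_trans cN; rewrite mulr_gt0.
rewrite lne_EFin// -EFinM !lee_fin.
have expand k : 0 < k -> a + ln k / - ln e = ln (k * e `^ (- a)) / - ln e.
  by move=> k0; rewrite lnM ?posrE// ln_powR; field; rewrite -oppr_eq0 gt_eqF.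
rewrite !expand// !ler_pM2r ?invr_gt0//.
by rewrite !ler_ln ?posrE ?mulr_gt0// cN NC.
Qed.

Lemma log_covering_ratio_near (h : R) : 0 < h ->
  (0:R)^'+ [set e | ((a - h)%:E <= log_covering_ratio F e <= (a + h)%:E)%E].
Proof.
move=> h0; pose M := (`|ln c| + `|ln C|) / h.
have ln_near : \forall e \near (0:R)^'+, ln e <= - (M + 1).
  by apply: cvgrNy_le; exact: lnNy.
(* [M + 1] rather than [M], so that [- ln e] is positive even if [M = 0]. *)
near=> e => /=.
have e01 : 0 < e < 1.
  apply/andP; split; near: e; [exact: nbhs_right_gt|exact: nbhs_right_lt].
have LM : M + 1 <= - ln e.
  by rewrite lerNr; near: e; exact: ln_near.
have M0 : 0 <= M by rewrite divr_ge0 ?addr_ge0// ltW.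
have L0 : 0 < - ln e by lra.
have small k : `|ln k| <= `|ln c| + `|ln C| -> - h <= ln k / - ln e <= h.
  move=> kM; rewrite -ler_norml normrM normfV (gtr0_norm L0) ler_pdivrMr//.
  apply: le_trans kM _; rewrite mulrC -ler_pdivrMr// -/M; lra.
have /andP[lo up] := log_covering_ratio_bounds e01.
have /andP[clo _] : - h <= ln c / - ln e <= h by apply: small; rewrite lerDl.
have /andP[_ Cup] : - h <= ln C / - ln e <= h by apply: small; rewrite lerDr.
apply/andP; split.
  by apply: le_trans lo; rewrite lee_fin lerD2l.
by apply: (le_trans up); rewrite lee_fin lerD2l.
Unshelve. all: by end_near. Qed.

Theorem hausdorff_dim_box_dim :
  [/\ hausdorff_dim F = a%:E, lower_box_dim F = a%:E & upper_box_dim F = a%:E].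
Proof.
split.
- by apply/eqP; rewrite eq_le hausdorff_dim_le hausdorff_dim_ge.
- by apply: limf_einf_squeeze => h; exact: log_covering_ratio_near.
- by apply: limf_esup_squeeze => h; exact: log_covering_ratio_near.
Qed.

End DimensionCriterion.

(** * Mass of covers from a parametrization with Hoelder inverse *)

Section HolderMass.
Variables (R : realType) (F : set R) (p : R -> R) (a K : R).
Hypotheses (a0 : 0 < a) (K0 : 0 < K).
Hypothesis pF : forall y, 0 <= y < 1 -> F (p y).
Hypothesis p_holder : forall y y', 0 <= y < 1 -> 0 <= y' < 1 ->
  `|y - y'| <= K * `|p y - p y'| `^ a.
Local Open Scope ereal_scope.

Let mu := @lebesgue_measure R.

(** If [diam U] is infinite, so is the bound, and the whole line will do. *)
Lemma preimage_in_itv (U : set R) : exists J : set R,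
  [/\ measurable J, forall y, (0 <= y < 1)%R -> U (p y) -> J y &
      mu J <= if U != set0 then (2 * K)%:E * diam U `^ a else 0].
Proof.
have [[y [y01 Uy]]|noy] := pselect (exists y, (0 <= y < 1)%R /\ U (p y));
    last first.
  exists set0; split=> // [y y01 Uy|]; first by apply: noy; exists y.
  rewrite /mu measure0; case: ifPn => // _.
  by rewrite mule_ge0 ?poweR_ge0// lee_fin mulr_ge0// ltW.
have U0 : U != set0 by apply/set0P; exists (p y).
rewrite U0; have := diam_ge0 U0; case diamU : (diam U) => [d| |]//.
- rewrite lee_fin => d0; pose r := (K * d `^ a)%R.
  have r0 : (0 <= r)%R by rewrite mulr_ge0 ?powR_ge0 ?ltW.
  exists `[(y - r)%R, (y + r)%R]%classic; split=> // [y' y'01 Uy'|].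
    have yy' : (`|y - y'| <= r)%R.
      apply: le_trans (p_holder y01 y'01) _; rewrite ler_pM2l//.
      rewrite ge0_ler_powR ?nnegrE ?(ltW a0)//.
      by rewrite -lee_fin -diamU dist_le_diam.
    by move: yy'; rewrite /= in_itv/= ler_norml => /andP[? ?]; apply/andP; lra.
  rewrite /mu lebesgue_measure_itv/= lte_fin -EFinM.
  case: ifPn => _; rewrite -?EFinD lee_fin /r; last by rewrite -mulrA mulr_ge0.
  lra.
- move=> _; exists setT; split => //.
  by rewrite poweRyr ?gt_eqF// gt0_muley ?leey// lte_fin mulr_gt0.
Qed.

(** The mass distribution principle, with the image of Lebesgue measure under
    [p] as the mass; enlarging the preimages to intervals avoids asking that
    they, or [p], be measurable. *)
Lemma cover_mass_of_holder (U : nat -> set R) : F `<=` \bigcup_i U i ->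
  ((2 * K)^-1)%:E <= \sum_(0 <= i <oo | U i != set0) diam (U i) `^ a.
Proof.
move=> FU; have /choice[J JP] := fun i => preimage_in_itv (U i).
have : mu `[0%R, 1%R[%classic <= \sum_(0 <= i <oo) mu (J i).
  apply: measure_sigma_subadditive => // [i|y]; first by have [] := JP i.
  rewrite /= in_itv/= => y01; have [i _ Uy] := FU _ (pF y01).
  by exists i => //; have [_ + _] := JP i; apply.
rewrite /mu lebesgue_measure_itv/= lte_fin ltr01 sube0 => mass.
suff : 1 <= (2 * K)%:E * \sum_(0 <= i <oo | U i != set0) diam (U i) `^ a.
  by rewrite -lee_pdivrMl ?mulr_gt0// mule1.
apply: le_trans mass _; rewrite -nneseriesZl; last first.
  by move=> *; exact: poweR_ge0.
rewrite [leRHS]eseries_mkcond; apply: lee_nneseries => // i _.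
by have [] := JP i.
Qed.

End HolderMass.

(** * Powers of one sixteenth *)

Lemma exists_sixteenth_scale (R : realType) (e : R) : 0 < e < 1 ->
  exists n, 16^-1 ^+ n.+1 <= e < 16^-1 ^+ n.
Proof.
move=> /andP[e0 e1].
have small : exists n, (16^-1 : R) ^+ n <= e.
  have /cvgr0Pnorm_lt/(_ e e0)[n _ /(_ n (leqnn n)) ne] :
      (16^-1 : R) ^+ n @[n --> \oo] --> 0.
    by apply: cvg_expr; rewrite ger0_norm; lra.
  by exists n; apply: ltW; apply: le_lt_trans ne; rewrite ler_norm.
case: (ex_minnP small) => -[|n] ne nmin.
  by move: ne; rewrite expr0 leNgt e1.
by exists n; rewrite ne ltNge; apply/negP => /nmin; rewrite ltnn.
Qed.

Lemma powR_sixteenth (R : realType) (n : nat) :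
  (16^-1 ^+ n : R) `^ (1 / 4) = 2^-1 ^+ n.
Proof.
have -> : 16^-1 ^+ n = (2^-1 ^+ n) `^ 4%:R :> R.
  by rewrite powR_mulrn ?exprn_ge0// exprAC; congr (_ ^+ n); field.
by rewrite -powRrM mul1r mulfV// powRr1// exprn_ge0.
Qed.

(** * The binary coding of the fractal prime set *)

Section Parametrization.
Variable R : realType.
Implicit Types (b : nat -> bool) (y : R).

Definition binary_prefix b n : R := \sum_(k < n) (b k)%:R * 2^-1 ^+ k.+1.

(** The integers [t n = truncn (2 ^+ n * y)] satisfy [(t n.+1)./2 = t n], so
    their parities are binary digits of [y] and the prefix of length [n] is
    [t n * 2 ^- n]. *)
Lemma exists_binary_expansion y : 0 <= y < 1 ->
  exists b, forall n, binary_prefix b n <= y <= binary_prefix b n + 2^-1 ^+ n.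
Proof.
move=> /andP[y0 y1]; pose t n := Num.truncn (2 ^+ n * y).
have sy0 n : 0 <= 2 ^+ n * y by rewrite mulr_ge0 ?exprn_ge0.
have tS n : t n.+1 = (odd (t n.+1) + (t n).*2)%N.
  suff <- : (t n.+1)./2 = t n by rewrite odd_double_half.
  apply/esym/eqP; rewrite truncn_eq//.
  have := truncn_itv (sy0 n.+1); rewrite -/(t _) exprS -mulrA.
  rewrite -{1 2}(odd_double_half (t n.+1)) -addnS -muln2 !natrD natrM.
  by rewrite -[in X in _ -> X]natr1; case: (odd _) => /= ?; apply/andP; lra.
exists (fun k => odd (t k.+1)) => n.
have -> : binary_prefix (fun k => odd (t k.+1)) n = (t n)%:R * 2^-1 ^+ n.
  elim: n => [|n IH].
    rewrite /binary_prefix big_ord0 expr0 mulr1 /t expr0 mul1r.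
    by have /eqP -> : Num.truncn y == 0%N; rewrite ?truncn_eq// y0 y1.
  rewrite /binary_prefix big_ord_recr/= [X in X + _]IH.
  rewrite [in RHS]tS natrD -muln2 natrM exprS.
  by field.
have p0 : (0 : R) < 2 ^+ n by rewrite exprn_gt0.
have := truncn_itv (sy0 n); rewrite -/(t n) -[(t n).+1%:R]natr1 => /andP[lo hi].
have q0 : (0 : R) < 2^-1 ^+ n by rewrite exprn_gt0.
have -> : y = 2 ^+ n * y * 2^-1 ^+ n.
  by rewrite exprVn mulrAC mulfV ?mul1r// gt_eqF.
apply/andP; split; first by rewrite ler_pM2r.
by apply: le_trans (ler_wpM2r (ltW q0) (ltW hi)) _; rewrite mulrDl mul1r.
Qed.

(** The two kept digits differ by [8] modulo [16], so the smaller one is the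
    residue modulo [8] and the bit says which of them is taken. *)
Definition selected_digit b k : nat := prime_digit k.+1 %% 8 + 8 * b k.

Lemma selected_digit_prime b k : (selected_digit b k == prime_digit k.+1) ||
  (selected_digit b k == prime_codigit k.+1).
Proof.
rewrite /selected_digit /prime_codigit.
have : (prime_digit k.+1 < 16)%N by rewrite ltn_mod.
by case: (b k); lia.
Qed.

Lemma selected_digit_lt b k : (selected_digit b k < 16)%N.
Proof. by rewrite /selected_digit; case: (b k); lia. Qed.

Definition stage_end b n : R :=
  \sum_(k < n) (selected_digit b k)%:R * 16^-1 ^+ k.+1.

Lemma stage_endS b n :
  stage_end b n.+1 = stage_end b n + (selected_digit b n)%:R * 16^-1 ^+ n.+1.
Proof. by rewrite /stage_end big_ord_recr. Qed.

Lemma mem_stage_ends b n : stage_end b n \in stage_ends R n.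
Proof.
elim: n => [|n IH]; first by rewrite /stage_end big_ord0 inE.
rewrite stage_endS /=; apply/flattenP; eexists; first exact: map_f IH.
rewrite !inE -exprVn.
by have /orP[/eqP ->|/eqP ->] := selected_digit_prime b n; rewrite eqxx ?orbT.
Qed.

Lemma size_stage_ends n : size (stage_ends R n) = (2 ^ n)%N.
Proof.
elim: n => //= n IH; rewrite size_flatten /shape -map_comp expnS -IH.
by elim: (stage_ends R n) => //= x l ->; rewrite mulnS.
Qed.

(** The chosen intervals are nested because digits are at most [15]. *)
Lemma stage_end_nested b n : stage_end b n <= stage_end b n.+1 /\
  stage_end b n.+1 + 16^-1 ^+ n.+1 <= stage_end b n + 16^-1 ^+ n.
Proof.
rewrite stage_endS exprS.
have q0 : 0 <= 16^-1 ^+ n :> R by rewrite exprn_ge0.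
have := selected_digit_lt b n; rewrite -ltnS -(ler_nat R) => d16.
have d0 : 0 <= (selected_digit b n)%:R :> R by [].
by split; nra.
Qed.

Lemma exists_coded_point b :
  exists x, forall n, stage_end b n <= x <= stage_end b n + 16^-1 ^+ n.
Proof.
have lo : {homo stage_end b : m n / (m <= n)%N >-> m <= n}.
  apply: homo_leq => [x|x y z|n]//; first exact: le_trans.
  exact: (stage_end_nested b n).1.
have hi : {homo (fun n => stage_end b n + 16^-1 ^+ n) :
    m n / (m <= n)%N >-> n <= m}.
  apply: (@homo_leq _ _ (fun u v => v <= u)) => [x|x y z ? ?|n]//.
    by apply: le_trans; eassumption.
  exact: (stage_end_nested b n).2.
have ub n : ubound (range (stage_end b)) (stage_end b n + 16^-1 ^+ n).
  move=> _ [m _ <-]; apply: le_trans (hi _ _ (leq_maxl n m)).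
  by apply: le_trans (lo _ _ (leq_maxr n m)) _; rewrite lerDl exprn_ge0.
exists (sup (range (stage_end b))) => n; apply/andP; split.
  apply: ub_le_sup; last by exists n.
  by exists (stage_end b 0 + 16^-1 ^+ 0); exact: ub.
by apply: ge_sup; [exists (stage_end b 0), 0%N|exact: ub].
Qed.

(** At the first differing bit the left endpoints are
    [8 * 16 ^- n.+1] apart while the intervals have length [16 ^- n.+1], so
    the two points are at least [7 * 16 ^- n.+1] apart. *)
Lemma coded_points_agree b b' (x x' : R) n :
  (forall m, stage_end b m <= x <= stage_end b m + 16^-1 ^+ m) ->
  (forall m, stage_end b' m <= x' <= stage_end b' m + 16^-1 ^+ m) ->
  `|x - x'| < 16^-1 ^+ n -> forall k, (k < n)%N -> b k = b' k.
Proof.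
move=> xb xb'; elim: n => // n IH xx'.
have q0 : 0 < 16^-1 ^+ n :> R by rewrite exprn_gt0.
have {}IH : forall k, (k < n)%N -> b k = b' k.
  by apply: IH; apply: lt_trans xx' _; rewrite exprS; lra.
suff bn : b n = b' n by move=> k; rewrite ltnS leq_eqVlt => /orP[/eqP ->|/IH].
have same : stage_end b n = stage_end b' n.
  by apply: eq_bigr => k _; rewrite /selected_digit IH.
move: (xb n.+1) (xb' n.+1) xx'; rewrite !stage_endS same exprS ltr_norml.
have digitE c : (selected_digit c n)%:R =
    (prime_digit n.+1 %% 8)%:R + 8 * (c n)%:R :> R by rewrite natrD natrM.
rewrite !digitE.
by case: (b n); case: (b' n) => //= /andP[? ?] /andP[? ?] /andP[? ?]; lra.
Qed.

(** The exponent is [ln 2 / ln 16]: agreement of [n] bits is distance [16 ^- n]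
    on one side and [2 ^- n] on the other. *)
Lemma exists_parametrization : exists p : R -> R,
  (forall y, 0 <= y < 1 -> fractal_prime_set R (p y)) /\
  (forall y y', 0 <= y < 1 -> 0 <= y' < 1 ->
     `|y - y'| <= 2 * `|p y - p y'| `^ (1 / 4)).
Proof.
have /choice[p pP] : forall y, exists x, 0 <= y < 1 -> exists b,
    (forall n, binary_prefix b n <= y <= binary_prefix b n + 2^-1 ^+ n) /\
    (forall n, stage_end b n <= x <= stage_end b n + 16^-1 ^+ n).
  move=> y; have [y01|_] := boolP (0 <= y < 1); last by exists 0.
  have [b yb] := exists_binary_expansion y01.
  have [x xb] := exists_coded_point b.
  by exists x => _; exists b.
exists p; split=> [y /pP[b [_ xb]] n _|y y' /pP[b [yb xb]] /pP[b' [yb' xb']]].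
  by exists (stage_end b n); rewrite /= ?mem_stage_ends// in_itv/= -exprVn.
have close n : `|p y - p y'| < 16^-1 ^+ n -> `|y - y'| <= 2^-1 ^+ n.
  move=> /(coded_points_agree xb xb') bb'.
  have same : binary_prefix b n = binary_prefix b' n.
    by apply: eq_bigr => k _; rewrite bb'.
  move: (yb n) (yb' n); rewrite same => /andP[? ?] /andP[? ?].
  by rewrite ler_norml; apply/andP; lra.
have [pp1|pp1] := leP 1 `|p y - p y'|.
  apply: (@le_trans _ _ 2); last first.
    by rewrite ler_peMr// -(powRr0 `|p y - p y'|) ler_powR//; lra.
  move: (yb 0%N) (yb' 0%N); rewrite /binary_prefix !big_ord0.
  move=> /andP[? ?] /andP[? ?].
  by rewrite ler_norml; apply/andP; lra.
(* If [p y = p y'], then [y] and [y'] agree to every order; the order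
   [4 * n.+2] is chosen because [2 ^- (4 * n.+2) = 16 ^- n.+2 < 16 ^- n.+1],
   a lower bound of their distance. *)
have [pp0|pp0] := eqVneq `|p y - p y'| 0.
  rewrite pp0 powR0 ?mulr0; last by lra.
  rewrite leNgt; apply/negP => yy0.
  have /exists_sixteenth_scale[n /andP[ny _]] : 0 < Num.min `|y - y'| 2^-1 < 1.
    by rewrite lt_min gt_min yy0; apply/andP; split; lra.
  have := close (4 * n.+2)%N; rewrite pp0 exprn_gt0// => /(_ isT).
  have -> : 2^-1 ^+ (4 * n.+2) = 16^-1 * 16^-1 ^+ n.+1 :> R.
    by rewrite exprM -exprS; congr (_ ^+ _); field.
  have : 0 < 16^-1 ^+ n.+1 :> R by rewrite exprn_gt0.
  have : Num.min `|y - y'| 2^-1 <= `|y - y'| by rewrite ge_min lexx.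
  lra.
have {pp1} : 0 < `|p y - p y'| < 1 by rewrite lt_def pp0 normr_ge0.
move=> /exists_sixteenth_scale[n /andP[lo hi]].
apply: le_trans (close n hi) _.
have -> : 2^-1 ^+ n = 2 * 2^-1 ^+ n.+1 :> R by rewrite exprS; field.
rewrite ler_pM2l// -powR_sixteenth ge0_ler_powR//.
by rewrite nnegrE exprn_ge0.
Qed.

(** If [16 ^- n.+1 <= e < 16 ^- n], the [2 ^ n.+1] intervals of stage [n.+1]
    fit in intervals of length [e], and [2 ^ n < e `^ (- (1 / 4))]; the extra
    factor [2] is the constant. *)
Lemma fractal_prime_set_few_intervals (e : R) : 0 < e < 1 -> exists2 t : seq R,
  fractal_prime_set R `<=` \bigcup_(x in [set` t]) `[x, (x + e)%R]%classic &
  (size t)%:R <= 2 * e `^ (- (1 / 4)).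
Proof.
move=> e01; have /andP[e0 _] := e01.
have [n /andP[lo hi]] := exists_sixteenth_scale e01.
exists (stage_ends R n.+1) => [x /(_ n.+1 I)[z zn xz]|].
  exists z => //; move: xz; rewrite /= !in_itv/= -exprVn => /andP[-> xz].
  by apply: le_trans xz _; rewrite lerD2l.
rewrite size_stage_ends powRN natrX exprS ler_pM2l//.
rewrite -[2 ^+ n]invrK lef_pV2 ?posrE ?invr_gt0 ?exprn_gt0 ?powR_gt0//.
rewrite -exprVn -powR_sixteenth ge0_ler_powR ?nnegrE ?exprn_ge0 ?ltW//; lra.
Qed.

End Parametrization.

Theorem theorem14 (R : realType) :
  box_dim_exists (fractal_prime_set R) /\
  hausdorff_dim (fractal_prime_set R) = box_dim (fractal_prime_set R) /\
  box_dim (fractal_prime_set R) = (1 / 4 : R)%R%:E%E.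
Proof.
have [p [pF p_holder]] := exists_parametrization R.
have a0 : (0 : R) < 1 / 4 by lra.
have mass := cover_mass_of_holder a0 (ltr0Sn R 1) pF p_holder.
have c0 : (0 : R) < (2 * 2)^-1 by lra.
have [dimH lowB uppB] := hausdorff_dim_box_dim a0 c0 (ltr0Sn R 1) mass
  (@fractal_prime_set_few_intervals R).
by rewrite /box_dim_exists /box_dim dimH lowB uppB.
Qed.
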